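(* Let $\{P_n(z)\}_{n=0}^\infty$ be a monic OPS with respect to a positive-definite linear functional $\mathcal{L}(p)=\int_a^bp(t)\,d\mu(t)$, where $d\mu$ is a positive measure with support contained in $[a,b]\subset\mathbb{R}$, and let $\kappa_1,\kappa_2\in\mathbb{C}_+$. Let $\{P_n^{**}(\kappa_1,\overline{\kappa_1},z)\}_{n=0}^\infty$ be the corresponding iterated kernel polynomials and let $\{P_n^{-**}(\kappa_2,\overline{\kappa_2},z)\}_{n=0}^\infty$ be the iterated Geronimus polynomials corresponding to $$s_0^*=\int_a^b\frac{d\mu(t)}{t-\kappa_2},\qquad s_0^{**}=\int_a^b\frac{d\mu(t)}{|t-\kappa_2|^2}.$$ Then there exist sequences of constants $\upsilon_n,\gamma_n$ such that, for $n\ge1$, $$P_{n+1}^{-**}(\kappa_2,\overline{\kappa_2},z)-((1+\upsilon_n)z-\gamma_n)P_n(z)+\upsilon_n(z-\kappa_1)(z-\overline{\kappa_1})P_{n-1}^{**}(\kappa_1,\overline{\kappa_1},z)=0.$$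
   Context: $\mathbb{C}_+=\{z:\operatorname{Im}z>0\}$. A functional $\mathcal{L}$ on $\mathbb{C}[z]$ is positive-definite if $\mathcal{L}[p]>0$ for every polynomial $p$ that is not identically zero and is non-negative on $\mathbb{R}$. A monic orthogonal polynomial system (OPS) for a functional $\mathcal{M}$ is a sequence of monic polynomials $p_n$ with $\deg p_n=n$, $\mathcal{M}[p_np_m]=0$ for $n\neq m$ and $\mathcal{M}[p_n^2]\neq0$. Kernel polynomials: $P_n^*(\kappa_1,z)=(z-\kappa_1)^{-1}\left[P_{n+1}(z)-\frac{P_{n+1}(\kappa_1)}{P_n(\kappa_1)}P_n(z)\right]$. Iterated kernel polynomials: $P_n^{**}(\kappa_1,\overline{\kappa_1},z)=(z-\overline{\kappa_1})^{-1}\left[P_{n+1}^*(\kappa_1,z)-\frac{P_{n+1}^*(\kappa_1,\overline{\kappa_1})}{P_n^*(\kappa_1,\overline{\kappa_1})}P_n^*(\kappa_1,z)\right]$; they form the monic OPS for $p\mapsto\mathcal{L}[(z-\kappa_1)(z-\overline{\kappa_1})p(z)]$. Geronimus polynomials: let $\mathcal{L}^{-*}$ be the functional with $\mathcal{L}^{-*}((z-\kappa_2)p(z))=\mathcal{L}(p(z))$ for all polynomials $p$ and $\mathcal{L}^{-*}(1)=s_0^*$. With $Q_n(z)=\mathcal{L}\left(\frac{P_n(z)-P_n(y)}{z-y}\right)_y$, set $P_0^{-*}=1$ and, for $n\ge1$, $P_n^{-*}(\kappa_2,z)=P_n(z)-\frac{s_0^*P_n(\kappa_2)+Q_n(\kappa_2)}{s_0^*P_{n-1}(\kappa_2)+Q_{n-1}(\kappa_2)}P_{n-1}(z)$.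 Iterated Geronimus polynomials: with $Q_n^{-*}(\kappa_2,z)=\mathcal{L}^{-*}\left(\frac{P_n^{-*}(\kappa_2,z)-P_n^{-*}(\kappa_2,y)}{z-y}\right)_y$, set $P_0^{-**}=1$ and, for $n\ge1$, $$P_n^{-**}(\kappa_2,\overline{\kappa_2},z)=P_n^{-*}(\kappa_2,z)-\frac{s_0^{**}P_n^{-*}(\kappa_2,\overline{\kappa_2})+Q_n^{-*}(\kappa_2,\overline{\kappa_2})}{s_0^{**}P_{n-1}^{-*}(\kappa_2,\overline{\kappa_2})+Q_{n-1}^{-*}(\kappa_2,\overline{\kappa_2})}P_{n-1}^{-*}(\kappa_2,z).$$ For the given $s_0^*,s_0^{**}$ these are well defined, and $\{P_n^{-**}(\kappa_2,\overline{\kappa_2},z)\}$ is the monic OPS with respect to the measure $d\mu(t)/|t-\kappa_2|^2$. *)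

(* Defs.v *)
From HB Require Import structures.
From mathcomp Require Import all_boot all_order all_algebra.
From mathcomp Require Import all_classical all_reals all_analysis.
From mathcomp Require Import complex.

Set Implicit Arguments.
Unset Strict Implicit.
Unset Printing Implicit Defensive.

Import Order.TTheory GRing.Theory Num.Theory.
Import numFieldNormedType.Exports.

Local Open Scope classical_set_scope.
Local Open Scope ring_scope.
Local Open Scope complex_scope.

Section OrthogonalPolynomials.
Variable F : fieldType.
Implicit Types (L : {scalar {poly F}}) (P : nat -> {poly F}).

Definition monic_OPS L P : Prop :=
  [/\ forall n, P n \is monic,
      forall n, size (P n) = n.+1,
      forall n m, n != m -> L (P n * P m) = 0
    & forall n, L (P n ^+ 2) != 0].

(* The bracket vanishes at kappa as soon as P_n(kappa) != 0, so that the
   Euclidean quotient below is then an exact division. *)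
Definition kernel_poly P (kappa : F) (n : nat) : {poly F} :=
  (P n.+1 - ((P n.+1).[kappa] / (P n).[kappa]) *: P n) %/ ('X - kappa%:P).

Definition iterated_kernel_poly P (kappa kappa' : F) : nat -> {poly F} :=
  kernel_poly (kernel_poly P kappa) kappa'.

(* L applied in y to (p(z) - p(y)) / (z - y): for a fixed number z this is a
   polynomial in y (here 'X), and the quotient is exact. *)
Definition second_kind L (p : {poly F}) (z : F) : F :=
  L ((p.[z]%:P - p) %/ (z%:P - 'X)).

Definition geronimus_functional L (kappa s : F) (L' : {scalar {poly F}}) :
    Prop :=
  (forall p, L' (('X - kappa%:P) * p) = L p) /\ L' 1 = s.

Definition geronimus_poly L P (kappa s : F) (n : nat) : {poly F} :=
  if n is m.+1 then
    P n - ((s * (P n).[kappa] + second_kind L (P n) kappa)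
           / (s * (P m).[kappa] + second_kind L (P m) kappa)) *: P m
  else 1.

(* L' is the Geronimus transform of L at kappa with L'(1) = s. *)
Definition iterated_geronimus_poly L L' P (kappa kappa' s s' : F) :
    nat -> {poly F} :=
  geronimus_poly L' (geronimus_poly L P kappa s) kappa' s'.

End OrthogonalPolynomials.

Section ComplexIntegral.
Variable R : realType.

Definition positive_definite (L : {scalar {poly R[i]}}) : Prop :=
  forall p : {poly R[i]}, p != 0 -> (forall x : R, 0 <= p.[x%:C]) -> 0 < L p.

Definition measure_support (mu : set (measurableTypeR R) -> \bar R) : set R :=
  [set x | forall U : set R, open_nbhs x U -> (0 < mu U)%E].

Definition complex_integral
    (mu : {finite_measure set (measurableTypeR R) -> \bar R})
    (D : set R) (f : R -> R[i]) : R[i] :=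
  (\int[mu]_(t in D) complex.Re (f t)) +i* (\int[mu]_(t in D) complex.Im (f t)).

End ComplexIntegral.

(* Main.v *)
(* Both (z - k1)(z - conj k1) P_(n-1)^** and P_(n+1)^-** are P_(n+1) plus a
   combination of P_n and P_(n-1); let beta and delta be their coefficients at
   P_(n-1), and let z P_n = P_(n+1) + b_n P_n + a_n P_(n-1).  Matching the
   coefficients at P_(n-1) requires delta + upsilon beta = (1 + upsilon) a_n,
   which is solvable as soon as beta <> a_n, whatever delta is; gamma then
   absorbs the P_n terms.  Here beta = W_n / W_(n-1) with
   W_n = P_(n+1)(k') P_n(k) - P_(n+1)(k) P_n(k'), k = k1, k' = conj k1, and
   the three-term recurrence gives
   W_n = (k' - k) |P_n(k)|^2 + a_n W_(n-1).  Since a_n > 0, W_n / (k' - k) > 0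
   for all n; this forces P_n(k) <> 0, and hence beta <> a_n. *)
Require Import Defs.
From mathcomp Require Import all_boot all_order all_algebra.
From mathcomp Require Import all_classical all_reals all_analysis.
From mathcomp Require Import complex.
From mathcomp Require Import ring.

Set Implicit Arguments.
Unset Strict Implicit.
Unset Printing Implicit Defensive.

Import Order.TTheory GRing.Theory Num.Theory.
Import numFieldNormedType.Exports.

Local Open Scope classical_set_scope.
Local Open Scope ring_scope.
Local Open Scope complex_scope.

(** * Orthogonality over a field and the three-term recurrence *)

Section OrthogonalPolynomialSystem.
Context {F : fieldType} {L : {scalar {poly F}}} {P : nat -> {poly F}}.
Hypothesis hP : monic_OPS L P.

Let P_monic n : P n \is monic. Proof. by case: hP. Qed.
Let size_P n : size (P n) = n.+1. Proof. by case: hP. Qed.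
Let P_orth n m : n != m -> L (P n * P m) = 0.
Proof. by case: hP => _ _ + _; apply. Qed.
Let P_norm n : L (P n * P n) != 0.
Proof. by rewrite -expr2; case: hP. Qed.

Let P_lead n : (P n)`_n = 1.
Proof. by move/monicP: (P_monic n); rewrite lead_coefE size_P. Qed.

Lemma size_sub_coef_OPS m (q : {poly F}) :
  (size q <= m.+1)%N -> (size (q - q`_m *: P m)%R <= m)%N.
Proof.
move=> sq; apply/leq_sizeP => j; rewrite leq_eqVlt => /predU1P[<-|mj].
  by rewrite coefB coefZ P_lead mulr1 subrr.
have -> : (q - q`_m *: P m)`_j = q`_j - q`_m * (P m)`_j by rewrite coefB coefZ.
have -> : (P m)`_j = 0 by rewrite nth_default ?size_P.
by rewrite mulr0 subr0 nth_default // (leq_trans sq).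
Qed.

Lemma OPS_orth_lower m k (q : {poly F}) :
  (size q <= m)%N -> (m <= k)%N -> L (q * P k) = 0.
Proof.
elim: m q => [|m IHm] q sq mk.
  by move: sq; rewrite leqn0 size_poly_eq0 => /eqP->; rewrite mul0r linear0.
rewrite -(subrK (q`_m *: P m) q) mulrDl linearD /=.
rewrite (IHm _ (size_sub_coef_OPS sq) (ltnW mk)).
by rewrite -scalerAl linearZ /= P_orth ?mulr0 ?addr0 // ltn_eqF.
Qed.

(** Pairing with [P m] isolates the top coefficient of [q]: the remainder has lower degree, and
    [L (P m * P m)] is nonzero. Polynomial identities can thus be checked by pairing with each
    [P k]. *)
Lemma OPS_separates m (q : {poly F}) :
  (size q <= m)%N -> (forall k, (k < m)%N -> L (q * P k) = 0) -> q = 0.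
Proof.
elim: m q => [|m IHm] q sq Lq.
  by apply/eqP; rewrite -size_poly_eq0 -leqn0.
have sr := size_sub_coef_OPS sq.
have qm0 : q`_m = 0.
  apply/eqP; have /eqP := Lq m (leqnn _).
  rewrite -(subrK (q`_m *: P m) q) mulrDl linearD /=.
  rewrite (OPS_orth_lower sr) // add0r -scalerAl linearZ /=.
  rewrite mulf_eq0 (negPf (P_norm m)) orbF.
  by rewrite coefD coefB coefZ P_lead mulr1 subrr add0r.
move: sr; rewrite qm0 scale0r subr0 => sr.
by apply: IHm => // k km; apply: Lq; apply: ltnW.
Qed.

Lemma OPS0 : P 0 = 1.
Proof.
have /size_poly1P[c _ Pc] : size (P 0) == 1 by rewrite size_P.
by have := P_lead 0; rewrite Pc coefC /= => ->.
Qed.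

Lemma size_mulX_OPS_sub n : (size ('X * P n - P n.+1)%R <= n.+1)%N.
Proof.
apply/leq_sizeP => j; rewrite leq_eqVlt => /predU1P[<-|nj].
  by rewrite coefB coefXM /= !P_lead subrr.
case: j nj => // j nj.
by rewrite coefB coefXM /= !nth_default ?subr0 // size_P.
Qed.

Lemma OPS_mulX_pred n : L ('X * P n * P n.+1) = L (P n.+1 * P n.+1).
Proof.
rewrite -(subrK (P n.+1) ('X * P n)) mulrDl linearD /=.
by rewrite (OPS_orth_lower (size_mulX_OPS_sub n)) // add0r.
Qed.

(** The recurrence coefficients. [OPS_a n] belongs to [P n] in ['X * P n.+1], so it is $a_{n+1}$ in
    the usual numbering; as a ratio of norms its sign is visible. *)
Definition OPS_b n := L ('X * P n * P n) / L (P n * P n).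
Definition OPS_a n := L (P n.+1 * P n.+1) / L (P n * P n).

Lemma OPS_mulX0 : 'X * P 0 = P 1 + OPS_b 0 *: P 0.
Proof.
apply/eqP; rewrite -subr_eq0 opprD addrA; apply/eqP.
apply: (@OPS_separates 1) => [|k].
  rewrite (leq_trans (size_polyD _ _)) // geq_max size_mulX_OPS_sub size_polyN.
  by rewrite (leq_trans (size_scale_leq _ _)) ?size_P.
rewrite ltnS leqn0 => /eqP->.
rewrite 2!mulrBl !linearB /= -scalerAl linearZ /= P_orth // subr0.
by rewrite divfK ?subrr // P_norm.
Qed.

Lemma OPS_mulXS n :
  'X * P n.+1 = P n.+2 + OPS_b n.+1 *: P n.+1 + OPS_a n *: P n.
Proof.
apply/eqP; rewrite -subr_eq0 !opprD !addrA; apply/eqP.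
apply: (@OPS_separates n.+2) => [|k].
  rewrite (leq_trans (size_polyD _ _)) // geq_max; apply/andP; split.
    rewrite (leq_trans (size_polyD _ _)) // geq_max size_mulX_OPS_sub size_polyN.
    by rewrite (leq_trans (size_scale_leq _ _)) ?size_P.
  by rewrite size_polyN (leq_trans (size_scale_leq _ _)) ?size_P.
rewrite !mulrBl !linearB /= -!scalerAl !linearZ /= => kn2.
rewrite (@P_orth n.+2) ?gtn_eqF // subr0.
move: kn2; rewrite ltnS leq_eqVlt => /predU1P[->|].
  rewrite (@P_orth n) ?ltn_eqF // mulr0 subr0.
  by rewrite divfK ?subrr // P_norm.
rewrite ltnS leq_eqVlt => /predU1P[->|kn].
  rewrite (@P_orth n.+1) ?gtn_eqF // mulr0 subr0.
  by rewrite mulrAC OPS_mulX_pred divfK ?subrr // P_norm.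
(* For [k < n], move ['X] onto [P k]: the product has degree below [n.+1], so [L] kills it against
   [P n.+1]. *)
rewrite (@P_orth n.+1) ?gtn_eqF ?(leqW kn) // (@P_orth n) ?gtn_eqF //.
rewrite !mulr0 !subr0 mulrAC (@OPS_orth_lower k.+2) //.
by rewrite (leq_trans (size_polyMleq _ _)) // size_polyX size_P.
Qed.

End OrthogonalPolynomialSystem.

Arguments OPS_b {F} L P n.
Arguments OPS_a {F} L P n.

(** * Expansions of the iterated transforms in the original OPS *)

Section IteratedTransforms.
Context {F : fieldType}.
Implicit Types (L : {scalar {poly F}}) (P : nat -> {poly F}).

Lemma kernel_polyK P k n : (P n).[k] != 0 ->
  ('X - k%:P) * kernel_poly P k n = P n.+1 - ((P n.+1).[k] / (P n).[k]) *: P n.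
Proof.
move=> Pk; rewrite /kernel_poly mulrC divpK // dvdp_XsubCl.
by rewrite /root !hornerE divfK // subrr.
Qed.

(** The numerator of the Christoffel-Darboux formula at the points [k], [k']. *)
Definition wronskian P (k k' : F) n :=
  (P n.+1).[k'] * (P n).[k] - (P n.+1).[k] * (P n).[k'].

Lemma horner_kernel_poly P k k' n : (P n).[k] != 0 -> k != k' ->
  (kernel_poly P k n).[k'] = wronskian P k k' n / ((k' - k) * (P n).[k]).
Proof.
move=> Pk kk'; have := congr1 (horner^~ k') (kernel_polyK Pk).
have dk : k' - k != 0 by rewrite subr_eq0 eq_sym.
rewrite !hornerE /wronskian => h.
apply: (mulfI dk); rewrite h; field.
by rewrite Pk dk.
Qed.

(** Each linear factor undoes the division of one kernel step. The coefficient at [P n] is a product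
    of two quotients in which the values of [P n] and [P n.+1] at [k] cancel. *)
Lemma iterated_kernel_expansion P k k' n :
    k != k' -> (P n).[k] != 0 -> (P n.+1).[k] != 0 -> wronskian P k k' n != 0 ->
  exists c, ('X - k%:P) * ('X - k'%:P) * iterated_kernel_poly P k k' n =
    P n.+2 - c *: P n.+1 + (wronskian P k k' n.+1 / wronskian P k k' n) *: P n.
Proof.
move=> kk' Pk P1k Wn.
have dk : k' - k != 0 by rewrite subr_eq0 eq_sym.
(* This makes the second division, by ['X - k'%:P], exact. *)
have Ksn : (kernel_poly P k n).[k'] != 0.
  by rewrite horner_kernel_poly // mulf_neq0 // invr_eq0 mulf_neq0.
rewrite -mulrA kernel_polyK // mulrBr -scalerAr !kernel_polyK //.
rewrite !horner_kernel_poly //; set d := (X in _ - X *: _).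
exists ((P n.+2).[k] / (P n.+1).[k] + d).
have -> : wronskian P k k' n.+1 / wronskian P k k' n
            = d * ((P n.+1).[k] / (P n).[k]).
  by rewrite /d; field; rewrite dk Pk P1k Wn.
by rewrite -!mul_polyC !(polyCD, polyCM); ring.
Qed.

(** Each Geronimus step subtracts a multiple of the preceding polynomial, so two steps reach back to
    [P n]. From index [n.+2] neither step meets the special value 1 at index 0. *)
Lemma iterated_geronimus_expansion L L' P k k' s s' n :
  exists c d, iterated_geronimus_poly L L' P k k' s s' n.+2 =
    P n.+2 - c *: P n.+1 + d *: P n.
Proof.
rewrite /iterated_geronimus_poly /=.
set f2 := (X in P n.+2 - X *: _); set f1 := (X in P n.+1 - X *: _).
set e := (X in _ - X *: (P n.+1 - _)).
exists (f2 + e), (e * f1).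
by rewrite -!mul_polyC !(polyCD, polyCM); ring.
Qed.

(** Substituting the recurrence at [k] and at [k'] cancels the [OPS_b] terms. *)
Lemma wronskianS L P k k' n : monic_OPS L P ->
  wronskian P k k' n.+1 =
    (k' - k) * ((P n.+1).[k] * (P n.+1).[k']) + OPS_a L P n * wronskian P k k' n.
Proof.
move=> hP; have E x : (P n.+2).[x] =
    x * (P n.+1).[x] - OPS_b L P n.+1 * (P n.+1).[x] - OPS_a L P n * (P n).[x].
  have := congr1 (horner^~ x) (OPS_mulXS hP n).
  by rewrite !hornerE => ->; ring.
by rewrite /wronskian !E; ring.
Qed.

Lemma wronskian0 L P k k' : monic_OPS L P -> wronskian P k k' 0 = k' - k.
Proof.
move=> hP; have E x : (P 1).[x] = x - OPS_b L P 0.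
  have := congr1 (horner^~ x) (OPS_mulX0 hP).
  by rewrite (OPS0 hP) !hornerE => h; rewrite {2}h addrK.
by rewrite /wronskian !E (OPS0 hP) !hornerE; ring.
Qed.

End IteratedTransforms.

(** * Reality, positivity and nonvanishing at non-real points *)

Section RealOrthogonalPolynomials.
Context {R : realType} {L : {scalar {poly R[i]}}} {P : nat -> {poly R[i]}}.
Hypothesis hpos : positive_definite L.
Hypothesis hP : monic_OPS L P.
Hypothesis L_real : forall p : {poly R[i]},
  (forall x : R, p.[x%:C] \is Num.real) -> L p \is Num.real.

Lemma OPS_real_norm_gt0 n :
  (forall x : R, (P n).[x%:C] \is Num.real) -> 0 < L (P n * P n).
Proof.
move=> Pr; apply: hpos => [|x]; last by rewrite hornerM -expr2 real_exprn_even_ge0.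
by case: hP => /(_ n)/monic_neq0 P0 _ _ _; rewrite mulf_neq0.
Qed.

Let conj_real (p : {poly R[i]}) : (forall z, p.[z^*%C] = p.[z]^*%C) ->
  forall x : R, p.[x%:C] \is Num.real.
Proof. by move=> pc x; apply/CrealP; rewrite -[RHS](congr1 _ (conjc_real x)) pc. Qed.

Let OPS_b_real n : (forall x : R, (P n).[x%:C] \is Num.real) ->
  (OPS_b L P n)^*%C = OPS_b L P n.
Proof.
move=> Pr; apply/CrealP/rpred_div; apply: L_real => x; rewrite !hornerE.
  by rewrite !rpredM // complex_real.
by rewrite rpredM.
Qed.

Let OPS_a_real n : (forall m (x : R), (m <= n.+1)%N -> (P m).[x%:C] \is Num.real) ->
  (OPS_a L P n)^*%C = OPS_a L P n.
Proof.
move=> Pr; apply/CrealP/rpred_div; apply: L_real => x;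
  by rewrite hornerM rpredM // Pr.
Qed.

(** Strong induction: symmetry of the earlier polynomials makes them real on the real line, hence by
    [L_real] the next recurrence coefficients are real, and the recurrence passes the symmetry
    on. *)
Lemma OPS_conj n z : (P n).[z^*%C] = (P n).[z]^*%C.
Proof.
elim/ltn_ind: n z => -[|[|n]] IHn z.
- by rewrite (OPS0 hP) !hornerE rmorph1.
- have E x : (P 1).[x] = x * (P 0).[x] - OPS_b L P 0 * (P 0).[x].
    have := congr1 (horner^~ x) (OPS_mulX0 hP).
    by rewrite !hornerE => ->; rewrite addrK.
  have : (OPS_b L P 0)^*%C = OPS_b L P 0.
    by apply/OPS_b_real/conj_real; apply: IHn.
  move: E; move: (OPS_b L P 0) => b E b_real.
  by rewrite !E IHn // rmorphB !rmorphM /= b_real.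
have E x : (P n.+2).[x] =
    x * (P n.+1).[x] - OPS_b L P n.+1 * (P n.+1).[x] - OPS_a L P n * (P n).[x].
  have := congr1 (horner^~ x) (OPS_mulXS hP n).
  by rewrite !hornerE => ->; ring.
have : (OPS_b L P n.+1)^*%C = OPS_b L P n.+1.
  by apply/OPS_b_real/conj_real; apply: IHn.
have : (OPS_a L P n)^*%C = OPS_a L P n.
  by apply: OPS_a_real => m x mn; apply: conj_real; apply: IHn.
move: E; move: (OPS_b L P n.+1) (OPS_a L P n) => b a E a_real b_real.
by rewrite !E !IHn // !rmorphB !rmorphM /= a_real b_real.
Qed.

Lemma OPS_a_gt0 n : 0 < OPS_a L P n.
Proof.
by rewrite divr_gt0 // OPS_real_norm_gt0 //; apply: conj_real; apply: OPS_conj.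
Qed.

Section NonRealPoint.
Variable k : R[i].
Hypothesis hk : k != k^*%C.

Let dk : k^*%C - k != 0. Proof. by rewrite subr_eq0 eq_sym. Qed.

Lemma wronskian_div_gt0 n : 0 < wronskian P k k^*%C n / (k^*%C - k).
Proof.
elim: n => [|n IHn]; first by rewrite (wronskian0 _ _ hP) divff.
rewrite (wronskianS _ _ _ hP) mulrDl mulrAC divff // mul1r -mulrA OPS_conj.
by rewrite ltr_wpDl ?mulcJ_ge0 // mulr_gt0 // OPS_a_gt0.
Qed.

Lemma wronskian_neq0 n : wronskian P k k^*%C n != 0.
Proof.
by apply/eqP => W0; have := wronskian_div_gt0 n; rewrite W0 mul0r ltxx.
Qed.

(** A zero at [k] is by conjugation also a zero at the conjugate point, and both products in the
    wronskian would vanish. *)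
Lemma OPS_neq0 n : (P n).[k] != 0.
Proof.
apply/eqP => Pk; have /eqP := wronskian_neq0 n; apply.
by rewrite /wronskian (OPS_conj n) Pk conjc0 !mulr0 subrr.
Qed.

(** By [wronskianS] the difference of the two sides is [k^*%C - k] times $|P_{n+1}(k)|^2$, divided
    by the nonzero wronskian at [n]. *)
Lemma wronskian_ratio_neq n :
  wronskian P k k^*%C n.+1 / wronskian P k k^*%C n != OPS_a L P n.
Proof.
rewrite -subr_eq0 (wronskianS _ _ _ hP) mulrDl mulfK ?wronskian_neq0 // addrK.
by rewrite !mulf_neq0 ?invr_eq0 ?wronskian_neq0 // ?OPS_conj ?conjc_eq0 ?OPS_neq0.
Qed.

End NonRealPoint.
End RealOrthogonalPolynomials.

(** * Integrals against the measure and the choice of the constants *)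

Lemma complex_integral_real (R : realType)
    (mu : {finite_measure set (measurableTypeR R) -> \bar R}) (D : set R)
    (f : R -> R[i]) :
  (forall x, f x \is Num.real) -> complex_integral mu D f \is Num.real.
Proof.
move=> fr; rewrite /complex_integral complex_real /Rintegral integral0_eq //.
by move=> x _; have /complex_realP[k ->] := fr x.
Qed.

Theorem corollary6p5 (R : realType) (a b : R)
    (mu : {finite_measure set (measurableTypeR R) -> \bar R})
    (L Ls : {scalar {poly R[i]}})
    (P : nat -> {poly R[i]})
    (kappa1 kappa2 s0s s0ss : R[i])
    (hsupp : measure_support mu `<=` `[a, b])
    (hL : forall p : {poly R[i]},
        L p = complex_integral mu `[a, b] (fun t : R => p.[t%:C]))
    (hpos : positive_definite L)
    (hP : monic_OPS L P)
    (hkappa1 : 0 < complex.Im kappa1)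
    (hkappa2 : 0 < complex.Im kappa2)
    (hs0s : s0s =
        complex_integral mu `[a, b] (fun t : R => (t%:C - kappa2)^-1))
    (hs0ss : s0ss =
        complex_integral mu `[a, b] (fun t : R => (`|t%:C - kappa2| ^+ 2)^-1))
    (hLs : geronimus_functional L kappa2 s0s Ls) :
  exists upsilon gamma : nat -> R[i],
    forall n : nat, (1 <= n)%N ->
      iterated_geronimus_poly L Ls P kappa2 (conjc kappa2) s0s s0ss n.+1
      - ((1 + upsilon n) *: 'X - (gamma n)%:P) * P n
      + upsilon n *: (('X - kappa1%:P) * ('X - (conjc kappa1)%:P)
                      * iterated_kernel_poly P kappa1 (conjc kappa1) n.-1)
      = 0.
Proof.
have L_real p : (forall x : R, p.[x%:C] \is Num.real) -> L p \is Num.real.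
  by move=> pr; rewrite hL; apply: complex_integral_real.
have hk : kappa1 != conjc kappa1.
  case: kappa1 hkappa1 => x y /= y0; apply/eqP => -[yN].
  by have := y0; rewrite {1}yN oppr_gt0 ltNge (ltW y0).
(* Shifting the index by one removes [n.-1]; the two uses of [choice] then turn pointwise constants
   into sequences, shifted back by [predn]. *)
suff step n : exists u g : R[i],
    iterated_geronimus_poly L Ls P kappa2 (conjc kappa2) s0s s0ss n.+2
    - ((1 + u) *: 'X - g%:P) * P n.+1
    + u *: (('X - kappa1%:P) * ('X - (conjc kappa1)%:P)
            * iterated_kernel_poly P kappa1 (conjc kappa1) n) = 0.
  have [u /choice[g hg]] := choice step.
  by exists (u \o predn), (g \o predn) => -[|n] // _; apply: hg.
have [c [d ->]] := iterated_geronimus_expansion L Ls P kappa2 (conjc kappa2) s0s s0ss n.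
have [e ->] := iterated_kernel_expansion hk
  (OPS_neq0 hpos hP L_real hk n) (OPS_neq0 hpos hP L_real hk n.+1)
  (wronskian_neq0 hpos hP L_real hk n).
have := wronskian_ratio_neq hpos hP L_real hk n.
set beta := _ / _; set alpha := OPS_a L P n => hab.
have hab0 : beta - alpha != 0 by rewrite subr_eq0.
(* The solution of [d + u * beta = (1 + u) * alpha], which compares coefficients at [P n]. *)
pose u := (alpha - d) / (beta - alpha).
have hd : d = alpha + u * alpha - u * beta.
  by rewrite /u; field.
(* The second witness cancels all terms in [P n.+1]; those in [P n.+2] cancel since
   [1 - (1 + u) + u = 0]. *)
exists u, (c + u * e + (1 + u) * OPS_b L P n.+1).
rewrite mulrBl -scalerAl (OPS_mulXS hP n) -/alpha hd.
by rewrite -!mul_polyC !(polyCB, polyCD, polyCM) polyC1; ring.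
Qed.
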